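(* Let $p$ be a prime integer. Let $\mathbb{Z}_p := \mathbb{Z}[[X]]/\!\sim$ be the commutative ring of $p$-adic integers, where $a\sim b$ means that the carried power series (mod $p$) of $a$ and $b$ are equal, i.e. $a^{\natural} = b^{\natural}$, with ring operations induced from $\mathbb{Z}[[X]]$. Equip $\mathbb{Z}_p$ with the apartness relation obtained by extending to the quotient the relation on $\mathbb{Z}[[X]]$ given by $$a \,\#\, b \quad\text{if and only if}\quad \exists n:\mathbb{N},\ \neg\,(a^{\natural}_n = b^{\natural}_n).$$ Then $\mathbb{Z}_p$ with this apartness relation is an apartness domain.
   Context: The setting is constructive (intuitionistic) mathematics in univalent type theory, with function extensionality and propositional univalence available. Equality $x=y$ means that the identity (path) type between $x$ and $y$ is inhabited; $\exists$ and ''or'' are the propositionally truncated existential quantifier and disjunction; relations are valued in propositions (types of h-level 1); quotients are set quotients. All rings are commutative with $1$. Prime: an integer $p$ is prime if $1<p$ and, for every positive integer $m$ dividing $p$, $m=1$ or $m=p$. Quotient and remainder: for an integer $c$, $\{c\}$ and $[c]$ denote the quotient and remainder of $c$ modulo $p$, i.e. the unique integers with $c = p\cdot\{c\}+[c]$ and $0\le [c]<p$. Formal power series: $\mathbb{Z}[[X]]$ is the set of sequences $a:\mathbb{N}\to\mathbb{Z}$ with $(a+b)_n := a_n+b_n$, $(a\cdot b)_n := \sum_{k=0}^n a_k b_{n-k}$, zero the constant sequence $0$, and unit given by $1_0:=1$, $1_{n+1}:=0$. Carrying: for $a\in\mathbb{Z}[[X]]$ define $\mathbf{p}(a)\in\mathbb{Z}[[X]]$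 by $\mathbf{p}(a)_0 := a_0$ and $\mathbf{p}(a)_{n+1} := a_{n+1}+\{\mathbf{p}(a)_n\}$. The carried power series of $a$ is $a^{\natural}$, given by $(a^{\natural})_n := [\mathbf{p}(a)_n]$. The equivalence relation $a\sim b :\Leftrightarrow a^{\natural}=b^{\natural}$ is a congruence for the ring operations of $\mathbb{Z}[[X]]$. An apartness relation on a set $X$ is a relation $R$ that is irreflexive ($\neg(xRx)$), symmetric ($xRy$ implies $yRx$) and cotransitive (if $xRy$, then for any $z$, $xRz$ or $zRy$). A commutative ring with compatible apartness is a commutative ring $A$ with an apartness relation $\#$ such that for all $a,b,c$ in $A$: (i) $(c+a)\,\#\,(c+b)$ implies $a\,\#\,b$; (ii) $(c\cdot a)\,\#\,(c\cdot b)$ implies $a\,\#\,b$. An apartness domain is a commutative ring with compatible apartness $A$ such that $1\,\#\,0$ and, for all $a,b$ in $A$, if $a\,\#\,0$ and $b\,\#\,0$ then $(a\cdot b)\,\#\,0$. *)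

(* Defs.v *)
(* Nothing classical is used: the only axioms involved are functional and
   propositional extensionality, so everything makes sense in constructive
   univalent mathematics.  This is why commutative rings are not MathComp's,
   whose carriers must be choice types. *)
From Stdlib Require Import ZArith Znumtheory Lia.
From Stdlib Require Import Ring_theory RelationClasses Morphisms.
From Stdlib Require Import FunctionalExtensionality PropExtensionality ClassicalFacts.

Set Implicit Arguments.
Open Scope Z_scope.

Record ring_data : Type := RingData {
  carrier :> Type;
  rzero : carrier;
  rone : carrier;
  radd : carrier -> carrier -> carrier;
  rmul : carrier -> carrier -> carrier;
  ropp : carrier -> carrier }.

Arguments radd {_} _ _.
Arguments rmul {_} _ _.
Arguments ropp {_} _.

(* [ring_theory] is the Stdlib record of the laws of a commutative ring with 1
   (the zero ring is allowed). *)
Definition is_comm_ring (A : ring_data) : Prop :=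
  ring_theory (rzero A) (rone A) (@radd A) (@rmul A)
    (fun x y => radd x (ropp y)) (@ropp A) eq.

Record is_apartness (X : Type) (R : X -> X -> Prop) : Prop := {
  apart_irrefl : forall x, ~ R x x;
  apart_sym : forall x y, R x y -> R y x;
  apart_cotrans : forall x y, R x y -> forall z, R x z \/ R z y }.

Record is_comm_ring_with_apartness (A : ring_data) (R : A -> A -> Prop) : Prop := {
  car_ring : is_comm_ring A;
  car_apart : is_apartness R;
  car_add : forall a b c : A, R (radd c a) (radd c b) -> R a b;
  car_mul : forall a b c : A, R (rmul c a) (rmul c b) -> R a b }.

Record is_apartness_domain (A : ring_data) (R : A -> A -> Prop) : Prop := {
  ad_ring : is_comm_ring_with_apartness A R;
  ad_one : R (rone A) (rzero A);
  ad_mul : forall a b : A,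
    R a (rzero A) -> R b (rzero A) -> R (rmul a b) (rzero A) }.

(* Voevodsky's set quotient: the type of equivalence classes of [R]. *)
Definition quotient (X : Type) (R : X -> X -> Prop) : Type :=
  {P : X -> Prop | exists x, forall y, P y <-> R x y}.

Definition class (X : Type) (R : X -> X -> Prop) (x : X) : quotient R :=
  exist _ (R x) (ex_intro _ x (fun y => iff_refl (R x y))).

Section Quotient.
Variables (X : Type) (R : X -> X -> Prop).
Hypothesis eqR : Equivalence R.

Lemma quot_map_class (f : X -> X) (fR : Proper (R ==> R) f) (P : quotient R) :
  exists x, forall y, (exists a, proj1_sig P a /\ R (f a) y) <-> R x y.
Proof.
destruct P as [P [a Pa]]; simpl; exists (f a); intro y; split.
- intros [b [Pb H]]; transitivity (f b); [apply fR, Pa, Pb | exact H].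
- intro H; exists a; split; [apply Pa; reflexivity | exact H].
Qed.

Lemma quot_map2_class (f : X -> X -> X) (fR : Proper (R ==> R ==> R) f)
    (P Q : quotient R) :
  exists x, forall y,
    (exists a b, proj1_sig P a /\ proj1_sig Q b /\ R (f a b) y) <-> R x y.
Proof.
destruct P as [P [a Pa]], Q as [Q [b Qb]]; simpl; exists (f a b); intro y; split.
- intros [a' [b' [Ha [Hb H]]]]; transitivity (f a' b'); [|exact H].
  apply fR; [apply Pa, Ha | apply Qb, Hb].
- intro H; exists a, b; repeat split; [apply Pa | apply Qb |]; auto; reflexivity.
Qed.

Definition quot_map (f : X -> X) (fR : Proper (R ==> R) f) (P : quotient R) :
  quotient R := exist _ _ (quot_map_class fR P).

Definition quot_map2 (f : X -> X -> X) (fR : Proper (R ==> R ==> R) f)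
  (P Q : quotient R) : quotient R := exist _ _ (quot_map2_class fR P Q).

Definition quot_rel (S : X -> X -> Prop) (P Q : quotient R) : Prop :=
  exists a b, proj1_sig P a /\ proj1_sig Q b /\ S a b.

Lemma quotient_ext (P Q : quotient R) :
  (forall x, proj1_sig P x <-> proj1_sig Q x) -> P = Q.
Proof.
destruct P as [P hP], Q as [Q hQ]; simpl; intro H.
assert (E : P = Q).
{ apply functional_extensionality; intro x.
  apply propositional_extensionality, H. }
subst Q; f_equal.
apply (ext_prop_dep_proof_irrel_cic propositional_extensionality).
Qed.

Lemma class_surj (P : quotient R) : exists x, P = class R x.
Proof.
destruct P as [P [x Px]]; exists x; apply quotient_ext; exact Px.
Qed.

Lemma class_eq (x y : X) : class R x = class R y <-> R x y.
Proof.
split; intro H.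
- pose proof (f_equal (fun P : quotient R => proj1_sig P y) H) as E; simpl in E.
  rewrite E; reflexivity.
- apply quotient_ext; simpl; intro z; split; intro Hz;
    [symmetry in H|]; etransitivity; eassumption.
Qed.

Lemma quot_mapE f (fR : Proper (R ==> R) f) x :
  quot_map fR (class R x) = class R (f x).
Proof.
apply quotient_ext; simpl; intro z; split.
- intros [a [Ha Hz]]; transitivity (f a); [apply fR|]; assumption.
- intro H; exists x; split; [reflexivity | exact H].
Qed.

Lemma quot_map2E f (fR : Proper (R ==> R ==> R) f) x y :
  quot_map2 fR (class R x) (class R y) = class R (f x y).
Proof.
apply quotient_ext; simpl; intro z; split.
- intros [a [b [Ha [Hb Hz]]]]; transitivity (f a b); [apply fR|]; assumption.
- intro H; exists x, y; repeat split; [reflexivity | reflexivity | exact H].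
Qed.

Lemma quot_relE S (SR : Proper (R ==> R ==> iff) S) x y :
  quot_rel S (class R x) (class R y) <-> S x y.
Proof.
split.
- intros [a [b [Ha [Hb H]]]]; simpl in *.
  apply (SR _ _ Ha _ _ Hb), H.
- intro H; exists x, y; simpl; repeat split; [reflexivity | reflexivity | exact H].
Qed.

End Quotient.

(* Stdlib's [prime] is phrased with [rel_prime]. *)
Lemma prime_iff (p : Z) :
  prime p <-> 1 < p /\ forall m, 0 < m -> (m | p) -> m = 1 \/ m = p.
Proof.
split.
- intro hp; split; [apply prime_ge_2 in hp; lia|].
  intros m m0 mp; destruct (prime_divisors p hp m mp) as [|[|[|]]];
    apply prime_ge_2 in hp; lia.
- intros [p1 H]; apply prime_alt; split; [exact p1|].
  intros n Hn np; destruct (H n); [lia | exact np | lia | lia].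
Qed.

Definition series : Type := nat -> Z.

(* [sumZ f n] is the sum of [f k] for k from 0 to n, both included. *)
Fixpoint sumZ (f : nat -> Z) (n : nat) : Z :=
  match n with
  | O => f O
  | S m => sumZ f m + f (S m)
  end.

Definition ps_zero : series := fun _ => 0.
Definition ps_one : series := fun n => match n with O => 1 | S _ => 0 end.
Definition ps_add (a b : series) : series := fun n => a n + b n.
Definition ps_opp (a : series) : series := fun n => - a n.
Definition ps_mul (a b : series) : series :=
  fun n => sumZ (fun k => a k * b (n - k)%nat) n.

(* For 0 < p, [c / p] and [c mod p] are the quotient and the remainder with
   0 <= c mod p < p, also for negative c (floor division). *)
Fixpoint carry (p : Z) (a : series) (n : nat) : Z :=
  match n with
  | O => a O
  | S m => a (S m) + carry p a m / p
  end.

Definition carried (p : Z) (a : series) : series := fun n => carry p a n mod p.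

Definition carry_eq (p : Z) (a b : series) : Prop := carried p a = carried p b.

Definition ps_apart (p : Z) (a b : series) : Prop :=
  exists n : nat, carried p a n <> carried p b n.

Global Instance carry_eq_equiv p : Equivalence (carry_eq p).
Proof.
split; unfold carry_eq; [intro | intros a b | intros a b c]; congruence.
Qed.

Global Instance ps_apart_proper p :
  Proper (carry_eq p ==> carry_eq p ==> iff) (ps_apart p).
Proof.
intros a a' Ha b b' Hb; unfold ps_apart; rewrite Ha, Hb; reflexivity.
Qed.

Lemma sumZ_ext f g n :
  (forall k, (k <= n)%nat -> f k = g k) -> sumZ f n = sumZ g n.
Proof.
induction n as [|n IH]; simpl; intro H; [apply H; lia|].
rewrite IH, H; [reflexivity | lia | intros; apply H; lia].
Qed.

Lemma sumZ_add f g n : sumZ (fun k => f k + g k) n = sumZ f n + sumZ g n.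
Proof. induction n as [|n IH]; simpl; [reflexivity | rewrite IH; ring]. Qed.

Lemma sumZ_scale c f n : sumZ (fun k => c * f k) n = c * sumZ f n.
Proof. induction n as [|n IH]; simpl; [reflexivity | rewrite IH; ring]. Qed.

Lemma sumZ_head f n : sumZ f (S n) = f O + sumZ (fun k => f (S k)) n.
Proof.
induction n as [|n IH]; [reflexivity|].
change (sumZ f (S n) + f (S (S n))
        = f O + (sumZ (fun k => f (S k)) n + f (S (S n)))).
rewrite IH; ring.
Qed.

Lemma sumZ_rev f n : sumZ f n = sumZ (fun k => f (n - k)%nat) n.
Proof.
induction n as [|n IH]; [reflexivity|].
rewrite (sumZ_head (fun k => f (S n - k)%nat)); simpl sumZ at 1.
rewrite IH, Nat.sub_0_r; simpl; ring.
Qed.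

Lemma ps_mul_comm a b n : ps_mul a b n = ps_mul b a n.
Proof.
unfold ps_mul; rewrite sumZ_rev; apply sumZ_ext; intros k Hk.
replace (n - (n - k))%nat with k by lia; ring.
Qed.

(* The product of q with the power series p - X: two series are identified
   exactly when their difference is such a product. *)
Definition mul_pX (p : Z) (q : series) : series :=
  fun n => match n with O => p * q O | S m => p * q (S m) - q m end.

Lemma carry_eqP p a b : p <> 0 ->
  carry_eq p a b <-> exists q, forall n, a n = b n + mul_pX p q n.
Proof.
intro p0; split.
- intro H; exists (fun n => carry p a n / p - carry p b n / p); intro n.
  assert (Hn : carry p a n mod p = carry p b n mod p)
    by exact (f_equal (fun s : series => s n) H).
  pose proof (Z.div_mod (carry p a n) p p0) as Ea.
  pose proof (Z.div_mod (carry p b n) p p0) as Eb.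
  destruct n as [|n]; simpl in *; lia.
- intros [q H].
  assert (E : forall n, carry p a n = carry p b n + q n * p).
  { induction n as [|n IH]; simpl; rewrite H; simpl; [ring|].
    rewrite IH, Z.div_add by exact p0; ring. }
  apply functional_extensionality; intro n; unfold carried.
  rewrite E; apply Z.mod_add, p0.
Qed.

Lemma carry_eq0 a b : carry_eq 0 a b -> a = b.
Proof.
intro H; apply functional_extensionality; intro n.
apply (f_equal (fun s : series => s n)) in H; unfold carried in H.
rewrite !Zmod_0_r in H.
destruct n as [|n]; simpl in H; [exact H|].
rewrite !Zdiv_0_r in H; lia.
Qed.

Lemma ps_mul_pX p q c n :
  ps_mul (mul_pX p q) c n = mul_pX p (ps_mul q c) n.
Proof.
destruct n as [|n]; [unfold ps_mul; simpl; ring|].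
unfold mul_pX at 2, ps_mul at 1.
rewrite sumZ_head; simpl mul_pX; rewrite Nat.sub_0_r.
rewrite (sumZ_ext _ (fun k => p * (q (S k) * c (S n - S k)%nat)
                              + -1 * (q k * c (n - k)%nat)))
  by (intros k Hk; replace (S n - S k)%nat with (n - k)%nat by lia; ring).
rewrite sumZ_add, !sumZ_scale.
unfold ps_mul; rewrite (sumZ_head _ n), Nat.sub_0_r; ring.
Qed.

Lemma carry_eq_mul_l p a b c :
  carry_eq p a b -> carry_eq p (ps_mul a c) (ps_mul b c).
Proof.
intro H; destruct (Z.eq_dec p 0) as [->|p0].
{ rewrite (carry_eq0 H); reflexivity. }
apply carry_eqP in H; [|exact p0]; destruct H as [q H].
apply carry_eqP; [exact p0|]; exists (ps_mul q c); intro n.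
rewrite <- ps_mul_pX; unfold ps_mul; rewrite <- sumZ_add.
apply sumZ_ext; intros k _; rewrite H; ring.
Qed.

Global Instance ps_add_proper p :
  Proper (carry_eq p ==> carry_eq p ==> carry_eq p) ps_add.
Proof.
intros a a' Ha b b' Hb; destruct (Z.eq_dec p 0) as [->|p0].
{ rewrite (carry_eq0 Ha), (carry_eq0 Hb); reflexivity. }
apply carry_eqP in Ha; [|exact p0]; destruct Ha as [q Hq].
apply carry_eqP in Hb; [|exact p0]; destruct Hb as [r Hr].
apply carry_eqP; [exact p0|]; exists (ps_add q r); intro n.
unfold ps_add; rewrite Hq, Hr; destruct n; simpl; ring.
Qed.

Global Instance ps_opp_proper p : Proper (carry_eq p ==> carry_eq p) ps_opp.
Proof.
intros a a' Ha; destruct (Z.eq_dec p 0) as [->|p0].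
{ rewrite (carry_eq0 Ha); reflexivity. }
apply carry_eqP in Ha; [|exact p0]; destruct Ha as [q Hq].
apply carry_eqP; [exact p0|]; exists (ps_opp q); intro n.
unfold ps_opp; rewrite Hq; destruct n; simpl; ring.
Qed.

Global Instance ps_mul_proper p :
  Proper (carry_eq p ==> carry_eq p ==> carry_eq p) ps_mul.
Proof.
intros a a' Ha b b' Hb; transitivity (ps_mul a' b).
{ apply carry_eq_mul_l, Ha. }
assert (C : forall x y, ps_mul x y = ps_mul y x)
  by (intros; apply functional_extensionality, ps_mul_comm).
rewrite (C a' b), (C a' b'); apply carry_eq_mul_l, Hb.
Qed.

(* The construction makes sense for every integer p. *)
Definition Zp (p : Z) : ring_data :=
  RingData (class (carry_eq p) ps_zero)
           (class (carry_eq p) ps_one)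
           (quot_map2 (carry_eq_equiv p) (@ps_add_proper p))
           (quot_map2 (carry_eq_equiv p) (@ps_mul_proper p))
           (quot_map (carry_eq_equiv p) (@ps_opp_proper p)).

Definition Zp_apart (p : Z) : Zp p -> Zp p -> Prop := quot_rel (ps_apart p).

Arguments Zp_apart p _ _ : clear implicits.

(* Main.v *)
(* Put V_n(a) = a_0 + a_1 p + ... + a_n p^n. The carry at n is the floor of
   V_n(a) / p^n, so a and b are apart exactly when, for some n, p^(n+1) does not
   divide V_n(a) - V_n(b). Modulo p^(n+1), V_n is a ring morphism and
   V_m = V_n for m >= n, so every claim becomes a divisibility statement about
   integers; the last one is that p^(s+1) not dividing x and p^(t+1) not
   dividing y imply that p^(s+t+1) does not divide x y. *)
Require Import Defs.
From Stdlib Require Import ZArith Znumtheory Lia.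
From Stdlib Require Import FunctionalExtensionality.

Set Implicit Arguments.
Open Scope Z_scope.

(** * Divisibility by powers of p in the integers *)

Lemma pow_of_nat_succ p n : p ^ Z.of_nat (S n) = p * p ^ Z.of_nat n.
Proof. rewrite Nat2Z.inj_succ; apply Z.pow_succ_r, Nat2Z.is_nonneg. Qed.

Lemma mod_eq_iff_divide m x y : m <> 0 -> x mod m = y mod m <-> (m | x - y).
Proof. intro m0; rewrite Z.cong_iff_0; apply Z.mod_divide, m0. Qed.

(** With m = p^n, this is how one more base-p digit enters a congruence: x mod mp is x mod m plus m
    times the digit (x / m) mod p. *)
Lemma mod_mul_eq m p x y : 0 < m -> 0 < p ->
  x mod (m * p) = y mod (m * p) <->
  x mod m = y mod m /\ (x / m) mod p = (y / m) mod p.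
Proof.
intros m0 p0; rewrite !Z.rem_mul_r by lia.
pose proof (Z.mod_pos_bound x m m0); pose proof (Z.mod_pos_bound y m m0).
split; [|intros [-> ->]; reflexivity].
(* Both remainders mod m lie in [0, m), so they differ by less than m, while distinct digits would
   contribute a difference of at least m. *)
intro E; assert (E1 : (x / m) mod p = (y / m) mod p) by nia.
rewrite E1 in E; split; [lia | exact E1].
Qed.

(** Induction on s + t: p divides x or y, and cancelling it lowers s or t by one. If that exponent
    is already 0, the factor found suffices. *)
Lemma prime_pow_divide_mul p s t x y : prime p ->
  (p ^ Z.of_nat (S (s + t)) | x * y) ->
  (p ^ Z.of_nat (S s) | x) \/ (p ^ Z.of_nat (S t) | y).
Proof.
intro hp; assert (p0 : p <> 0) by (apply prime_ge_2 in hp; lia).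
remember (s + t)%nat as n eqn:En; revert s t x y En.
induction n as [|n IH]; intros s t x y En H.
{ assert (s = O /\ t = O) as [-> ->] by lia.
  change (p ^ Z.of_nat 1) with (p ^ 1) in *; rewrite Z.pow_1_r in *.
  apply prime_mult; assumption. }
rewrite pow_of_nat_succ in H.
assert (D : (p | x * y)) by (eapply Z.divide_trans; [apply Z.divide_factor_l | exact H]).
destruct (prime_mult p hp _ _ D) as [[x' ->] | [y' ->]].
- destruct s as [|s]; [left; change (p ^ Z.of_nat 1) with (p ^ 1);
    rewrite Z.pow_1_r; apply Z.divide_factor_r|].
  replace (x' * p * y) with (p * (x' * y)) in H by ring.
  apply Z.mul_divide_cancel_l in H; [|exact p0].
  destruct (IH s t x' y ltac:(lia) H) as [K|K]; [left | right; exact K].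
  rewrite pow_of_nat_succ, (Z.mul_comm x'); apply Z.mul_divide_mono_l, K.
- destruct t as [|t]; [right; change (p ^ Z.of_nat 1) with (p ^ 1);
    rewrite Z.pow_1_r; apply Z.divide_factor_r|].
  replace (x * (y' * p)) with (p * (x * y')) in H by ring.
  apply Z.mul_divide_cancel_l in H; [|exact p0].
  destruct (IH s t x y' ltac:(lia) H) as [K|K]; [left; exact K | right].
  rewrite pow_of_nat_succ, (Z.mul_comm y'); apply Z.mul_divide_mono_l, K.
Qed.

(** * Ring laws for power series *)

Definition shift (a : series) : series := fun n => a (S n).

(** Since a = a_0 + X * [shift a], peeling off the constant term of the left factor allows
    inductions on the degree. *)
Lemma ps_mul_succ a b n :
  ps_mul a b (S n) = a O * b (S n) + ps_mul (shift a) b n.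
Proof. unfold ps_mul; rewrite sumZ_head; reflexivity. Qed.

Lemma ps_mul_one_l a n : ps_mul ps_one a n = a n.
Proof.
destruct n as [|n]; [apply Z.mul_1_l|].
rewrite ps_mul_succ; unfold ps_mul.
rewrite (sumZ_ext _ (fun k => 0 * 0)) by reflexivity.
rewrite sumZ_scale; simpl ps_one; ring.
Qed.

Lemma ps_mul_add_l a b c n :
  ps_mul (ps_add a b) c n = ps_add (ps_mul a c) (ps_mul b c) n.
Proof.
unfold ps_add, ps_mul; rewrite <- sumZ_add.
apply sumZ_ext; intros; ring.
Qed.

Lemma ps_mul_scale_l x a b n :
  ps_mul (fun k => x * a k) b n = x * ps_mul a b n.
Proof.
unfold ps_mul; rewrite <- sumZ_scale; apply sumZ_ext; intros; ring.
Qed.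

Lemma ps_mul_assoc a b c n :
  ps_mul a (ps_mul b c) n = ps_mul (ps_mul a b) c n.
Proof.
revert a; induction n as [|n IH]; intro a; [unfold ps_mul; simpl; ring|].
rewrite (ps_mul_succ a), (ps_mul_succ (ps_mul a b)), (ps_mul_succ b), IH.
replace (shift (ps_mul a b))
  with (ps_add (fun k => a O * shift b k) (ps_mul (shift a) b))
  by (apply functional_extensionality; intro k; symmetry; apply ps_mul_succ).
rewrite ps_mul_add_l; unfold ps_add; rewrite ps_mul_scale_l.
change (ps_mul a b O) with (a O * b O); ring.
Qed.

(** * The truncated values V_n at X = p *)

Definition partial_value (p : Z) (a : series) (n : nat) : Z :=
  sumZ (fun k => p ^ Z.of_nat k * a k) n.

(** Horner's scheme, matching the recursion of [ps_mul_succ]. *)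
Lemma partial_value_succ p a n :
  partial_value p a (S n) = a O + p * partial_value p (shift a) n.
Proof.
unfold partial_value; rewrite sumZ_head, <- sumZ_scale; f_equal.
- apply Z.mul_1_l.
- apply sumZ_ext; intros k _; rewrite pow_of_nat_succ; unfold shift; ring.
Qed.

Lemma partial_value_zero p n : partial_value p ps_zero n = 0.
Proof.
induction n as [|n IH]; [reflexivity|].
rewrite partial_value_succ; change (shift ps_zero) with ps_zero.
rewrite IH; unfold ps_zero; ring.
Qed.

Lemma partial_value_one p n : partial_value p ps_one n = 1.
Proof.
destruct n as [|n]; [reflexivity|].
rewrite partial_value_succ; change (shift ps_one) with ps_zero.
rewrite partial_value_zero; simpl ps_one; ring.
Qed.

Lemma partial_value_add p a b n :
  partial_value p (ps_add a b) n = partial_value p a n + partial_value p b n.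
Proof.
unfold partial_value; rewrite <- sumZ_add.
apply sumZ_ext; intros; unfold ps_add; ring.
Qed.

Lemma partial_value_scale p x a n :
  partial_value p (fun k => x * a k) n = x * partial_value p a n.
Proof.
unfold partial_value; rewrite <- sumZ_scale.
apply sumZ_ext; intros; ring.
Qed.

Lemma partial_value_stable p a n m :
  (p ^ Z.of_nat (S n) | partial_value p a (n + m) - partial_value p a n).
Proof.
induction m as [|m IH].
{ rewrite Nat.add_0_r, Z.sub_diag; apply Z.divide_0_r. }
rewrite Nat.add_succ_r.
change (partial_value p a (S (n + m)))
  with (partial_value p a (n + m) + p ^ Z.of_nat (S (n + m)) * a (S (n + m))).
rewrite Z.add_sub_swap; apply Z.divide_add_r; [exact IH|].
replace (Z.of_nat (S (n + m))) with (Z.of_nat (S n) + Z.of_nat m) by lia.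
rewrite Z.pow_add_r, <- Z.mul_assoc by lia; apply Z.divide_factor_l.
Qed.

(** The product V_n(a) V_n(b) has, beyond V_n(ab), only terms a_i b_j p^(i+j) with i + j > n. The
    induction peels off a_0 instead of handling this double sum. *)
Lemma partial_value_mul p a b n :
  (p ^ Z.of_nat (S n) |
    partial_value p (ps_mul a b) n - partial_value p a n * partial_value p b n).
Proof.
revert a; induction n as [|n IH]; intro a.
{ exists 0; change (1 * (a O * b O) - 1 * a O * (1 * b O) = 0 * p ^ Z.of_nat 1); ring. }
assert (E : partial_value p (ps_mul a b) (S n)
            = a O * partial_value p b (S n)
              + p * partial_value p (ps_mul (shift a) b) n).
{ rewrite (partial_value_succ p b), partial_value_succ.
  replace (shift (ps_mul a b))
    with (ps_add (fun k => a O * shift b k) (ps_mul (shift a) b))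
    by (apply functional_extensionality; intro k; symmetry; apply ps_mul_succ).
  rewrite partial_value_add, partial_value_scale.
  change (ps_mul a b O) with (a O * b O); ring. }
rewrite E, (partial_value_succ p a), pow_of_nat_succ.
destruct (IH (shift a)) as [u Hu].
destruct (partial_value_stable p b n 1) as [v Hv].
rewrite Nat.add_1_r in Hv.
(* After a_0 V_{n+1}(b) cancels, u accounts for the error of the inductive hypothesis, and v for
   replacing V_n(b) by V_{n+1}(b), multiplied by V_n of [shift a]. *)
exists (u - partial_value p (shift a) n * v).
transitivity (p * (u * p ^ Z.of_nat (S n)
  - partial_value p (shift a) n * (v * p ^ Z.of_nat (S n)))); [|ring].
rewrite <- Hu, <- Hv; ring.
Qed.

(** * Apartness as non-divisibility *)

Lemma carry_partial_value p a n : 0 < p ->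
  carry p a n = partial_value p a n / p ^ Z.of_nat n.
Proof.
intro p0; induction n as [|n IH].
{ change (a O = 1 * a O / 1); rewrite Z.div_1_r, Z.mul_1_l; reflexivity. }
assert (Pn : 0 < p ^ Z.of_nat n) by (apply Z.pow_pos_nonneg; lia).
change (a (S n) + carry p a n / p
  = (partial_value p a n + p ^ Z.of_nat (S n) * a (S n)) / p ^ Z.of_nat (S n)).
rewrite pow_of_nat_succ, (Z.mul_comm _ (a _)), Z.div_add by nia.
(* Nested floor divisions compose: dividing by p^n and then by p is dividing by p^(n+1). *)
rewrite IH, Z.div_div, (Z.mul_comm p) by lia; ring.
Qed.

Lemma ps_apart_iff p a b : 0 < p ->
  ps_apart p a b <->
  exists n, ~ (p ^ Z.of_nat (S n) | partial_value p a n - partial_value p b n).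
Proof.
intro p0.
assert (Pn : forall n, 0 < p ^ Z.of_nat n) by (intro; apply Z.pow_pos_nonneg; lia).
assert (digit : forall n,
  (p ^ Z.of_nat (S n) | partial_value p a n - partial_value p b n) <->
  (p ^ Z.of_nat n | partial_value p a n - partial_value p b n) /\
  carried p a n = carried p b n).
{ intro n; unfold carried; rewrite !carry_partial_value by exact p0.
  rewrite <- !mod_eq_iff_divide by (apply Z.neq_sym, Z.lt_neq, Pn).
  rewrite pow_of_nat_succ, (Z.mul_comm p); apply mod_mul_eq; auto. }
split.
{ intros [n Hn]; exists n; intro D; apply Hn, digit, D. }
(* Descending search for a differing digit, constructive because divisibility of integers is
   decidable. If p^(n+1) divides the difference of the V_n, it divides that of the V_{n+1} by
   stability, so digit n+1 must differ; otherwise the search continues from n. *)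
intros [n Hn]; induction n as [|n IH].
{ exists O; intro E; apply Hn, digit; split; [apply Z.divide_1_l | exact E]. }
destruct (Zdivide_dec (p ^ Z.of_nat (S n)) (partial_value p a n - partial_value p b n))
  as [D|D]; [|exact (IH D)].
exists (S n); intro E; apply Hn, digit; split; [|exact E].
pose proof (partial_value_stable p a n 1) as Sa.
pose proof (partial_value_stable p b n 1) as Sb.
rewrite Nat.add_1_r in Sa, Sb.
replace (partial_value p a (S n) - partial_value p b (S n))
  with (partial_value p a (S n) - partial_value p a n
        - (partial_value p b (S n) - partial_value p b n)
        + (partial_value p a n - partial_value p b n)) by ring.
apply Z.divide_add_r; [apply Z.divide_sub_r|]; assumption.
Qed.

(** * The apartness domain axioms on power series *)

Lemma ps_apart_add p a b c : 0 < p ->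
  ps_apart p (ps_add c a) (ps_add c b) -> ps_apart p a b.
Proof.
intro p0; rewrite !ps_apart_iff by exact p0; intros [n Hn]; exists n.
rewrite !partial_value_add in Hn; intro D; apply Hn.
replace (partial_value p a n - partial_value p b n)
  with (partial_value p c n + partial_value p a n
        - (partial_value p c n + partial_value p b n)) in D by ring.
exact D.
Qed.

Lemma ps_apart_mul p a b c : 0 < p ->
  ps_apart p (ps_mul c a) (ps_mul c b) -> ps_apart p a b.
Proof.
intro p0; rewrite !ps_apart_iff by exact p0; intros [n Hn]; exists n.
intro D; apply Hn.
(* The first two differences are multiplicativity errors, both divisible by p^(n+1). *)
replace (partial_value p (ps_mul c a) n - partial_value p (ps_mul c b) n)
  with ((partial_value p (ps_mul c a) n - partial_value p c n * partial_value p a n)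
        - (partial_value p (ps_mul c b) n - partial_value p c n * partial_value p b n)
        + partial_value p c n * (partial_value p a n - partial_value p b n)) by ring.
apply Z.divide_add_r; [apply Z.divide_sub_r; apply partial_value_mul|].
apply Z.divide_mul_r, D.
Qed.

Lemma ps_apart_one_zero p : 1 < p -> ps_apart p ps_one ps_zero.
Proof.
intro p1; exists O; unfold carried; simpl.
rewrite Z.mod_1_l, Z.mod_0_l by lia; discriminate.
Qed.

Lemma ps_apart_mul_zero p a b : prime p ->
  ps_apart p a ps_zero -> ps_apart p b ps_zero ->
  ps_apart p (ps_mul a b) ps_zero.
Proof.
intro hp; assert (p0 : 0 < p) by (apply prime_ge_2 in hp; lia).
rewrite !ps_apart_iff by exact p0; intros [s Hs] [t Ht]; exists (s + t)%nat.
rewrite !partial_value_zero, !Z.sub_0_r in *; intro D.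
assert (D' : (p ^ Z.of_nat (S (s + t)) |
              partial_value p a (s + t) * partial_value p b (s + t))).
{ replace (partial_value p a (s + t) * partial_value p b (s + t))
    with (partial_value p (ps_mul a b) (s + t)
          - (partial_value p (ps_mul a b) (s + t)
             - partial_value p a (s + t) * partial_value p b (s + t))) by ring.
  apply Z.divide_sub_r; [exact D | apply partial_value_mul]. }
destruct (prime_pow_divide_mul _ _ _ _ hp D') as [K|K]; [apply Hs | apply Ht].
(* The witnesses concern V_s(a) and V_t(b), not index s + t; stability modulo p^(s+1), respectively
   p^(t+1), brings the divisibility back to them. *)
- pose proof (Z.divide_sub_r _ _ _ K (partial_value_stable p a s t)) as L.
  rewrite Z.sub_sub_distr, Z.sub_diag in L; exact L.
- rewrite (Nat.add_comm s t) in K.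
  pose proof (Z.divide_sub_r _ _ _ K (partial_value_stable p b t s)) as L.
  rewrite Z.sub_sub_distr, Z.sub_diag in L; exact L.
Qed.

Lemma ps_apart_is_apartness p : is_apartness (ps_apart p).
Proof.
split.
- intros a [n Hn]; apply Hn; reflexivity.
- intros a b [n Hn]; exists n; apply not_eq_sym, Hn.
- intros a b [n Hn] c.
  (* Cotransitivity needs no excluded middle: at the fixed index n, equality of integer digits is
     decidable. *)
  destruct (Z.eq_dec (carried p a n) (carried p c n)) as [E|E];
    [right; exists n; rewrite <- E; exact Hn | left; exists n; exact E].
Qed.

(** * Passage to the quotient *)

Lemma Zp_apartE p a b :
  Zp_apart p (class (carry_eq p) a) (class (carry_eq p) b) <-> ps_apart p a b.
Proof. apply quot_relE; exact _. Qed.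

Lemma Zp_is_comm_ring p : is_comm_ring (Zp p).
Proof.
(* Each ring law already holds coefficientwise in the power series, before carrying. *)
assert (cong : forall a b : series, (forall n, a n = b n) ->
  class (carry_eq p) a = class (carry_eq p) b)
  by (intros a b H; f_equal; apply functional_extensionality, H).
split; simpl; repeat match goal with
  | |- forall _ : quotient _, _ =>
    let P := fresh "P" in let x := fresh "x" in
    intro P; destruct (class_surj P) as [x ->]
  end; rewrite ?quot_mapE, ?quot_map2E; apply cong; intro n.
- reflexivity.
- apply Z.add_comm.
- apply Z.add_assoc.
- apply ps_mul_one_l.
- apply ps_mul_comm.
- apply ps_mul_assoc.
- apply ps_mul_add_l.
- reflexivity.
- apply Z.add_opp_diag_r.
Qed.

Lemma Zp_apart_is_apartness p : is_apartness (Zp_apart p).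
Proof.
destruct (ps_apart_is_apartness p) as [irr sym cot].
split; intro P; destruct (class_surj P) as [a ->].
- rewrite Zp_apartE; apply irr.
- intro Q; destruct (class_surj Q) as [b ->].
  rewrite !Zp_apartE; apply sym.
- intro Q; destruct (class_surj Q) as [b ->]; intros H T.
  destruct (class_surj T) as [c ->].
  rewrite Zp_apartE in *; rewrite Zp_apartE; exact (cot _ _ H c).
Qed.

Theorem theorem6p14 (p : Z) (hp : prime p) :
  is_apartness_domain (Zp p) (Zp_apart p).
Proof.
assert (p1 : 1 < p) by (apply prime_ge_2 in hp; lia).
assert (p0 : 0 < p) by lia.
split; [split|..].
- apply Zp_is_comm_ring.
- apply Zp_apart_is_apartness.
- intros P Q T; destruct (class_surj P) as [a ->], (class_surj Q) as [b ->],
    (class_surj T) as [c ->]; simpl radd.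
  rewrite !quot_map2E, !Zp_apartE; apply ps_apart_add, p0.
- intros P Q T; destruct (class_surj P) as [a ->], (class_surj Q) as [b ->],
    (class_surj T) as [c ->]; simpl rmul.
  rewrite !quot_map2E, !Zp_apartE; apply ps_apart_mul, p0.
- apply Zp_apartE, ps_apart_one_zero, p1.
- intros P Q; destruct (class_surj P) as [a ->], (class_surj Q) as [b ->]; simpl.
  rewrite quot_map2E, !Zp_apartE; apply ps_apart_mul_zero, hp.
Qed.
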